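(* Let $Y$ be a graph on $n\ge 4$ vertices. Then the friends-and-strangers graph $\mathsf{FS}(K_{2,n-2},Y)$ is connected if and only if $Y$ is a connected non-bipartite graph with no non-trivial cut edge and $Y$ is not (isomorphic to) the cycle $C_n$.
   Context: All graphs are finite and simple, without loops. $C_n$ is the cycle on $n$ vertices and $K_{2,n-2}$ is the complete bipartite graph with parts of sizes $2$ and $n-2$. Friends-and-strangers graph: for graphs $X,Y$ each with $n$ vertices, $\mathsf{FS}(X,Y)$ is the graph whose vertices are all bijections $\sigma:V(X)\to V(Y)$; two bijections $\sigma,\sigma'$ are adjacent if and only if there is an edge $ab\in E(X)$ such that $\sigma(a)\sigma(b)\in E(Y)$, $\sigma(a)=\sigma'(b)$, $\sigma(b)=\sigma'(a)$, and $\sigma(c)=\sigma'(c)$ for all $c\in V(X)\setminus\{a,b\}$. A cut edge of a connected graph is an edge whose removal results in a disconnected graph; a cut edge is non-trivial if neither of its ends has degree one. *)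

(* Defs.v *)
From mathcomp Require Import all_boot.

Set Implicit Arguments.
Unset Strict Implicit.
Unset Printing Implicit Defensive.

Record sgraph := SGraph {
  svertex :> finType;
  sedge : rel svertex;
  sedge_sym : symmetric sedge;
  sedge_irrefl : irreflexive sedge }.

(* The graph with no vertices does not count as connected. *)
Definition connected_graph (G : sgraph) : Prop :=
  0 < #|G| /\ forall x y : G, connect (@sedge G) x y.

Definition bipartite (G : sgraph) : Prop :=
  exists c : G -> bool, forall x y : G, sedge x y -> c x != c y.

Definition isomorphic (G H : sgraph) : Prop :=
  exists f : G -> H, bijective f /\ forall x y : G, sedge (f x) (f y) = sedge x y.

Definition degree (G : sgraph) (x : G) : nat := #|[set y | sedge x y]|.

Section DeleteEdge.
Variables (G : sgraph) (a b : G).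

Definition del_rel : rel G :=
  fun x y => sedge x y && ([set x; y] != [set a; b]).

Lemma del_rel_sym : symmetric del_rel.
Proof. by move=> x y; rewrite /del_rel sedge_sym setUC. Qed.

Lemma del_rel_irrefl : irreflexive del_rel.
Proof. by move=> x; rewrite /del_rel sedge_irrefl. Qed.

Definition del_edge : sgraph := SGraph del_rel_sym del_rel_irrefl.

End DeleteEdge.

Definition cut_edge (G : sgraph) (a b : G) : Prop :=
  sedge a b /\ ~ connected_graph (del_edge a b).

Definition nontrivial_cut_edge (G : sgraph) (a b : G) : Prop :=
  [/\ cut_edge a b, degree a <> 1 & degree b <> 1].

Section Cycle.
Variable n : nat.

(* ordS is the successor modulo n. The conjunct i != j only matters for n = 1. *)
Definition cycle_rel : rel 'I_n :=
  fun i j => (i != j) && ((j == ordS i) || (i == ordS j)).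

Lemma cycle_rel_sym : symmetric cycle_rel.
Proof. by move=> i j; rewrite /cycle_rel eq_sym orbC. Qed.

Lemma cycle_rel_irrefl : irreflexive cycle_rel.
Proof. by move=> i; rewrite /cycle_rel eqxx. Qed.

Definition cycle_graph : sgraph := SGraph cycle_rel_sym cycle_rel_irrefl.

End Cycle.

Section CompleteBipartite.
Variables m n : nat.

Definition complete_bipartite_rel : rel ('I_m + 'I_n)%type :=
  fun u v => match u, v with
             | inl _, inr _ | inr _, inl _ => true
             | _, _ => false
             end.

Lemma complete_bipartite_rel_sym : symmetric complete_bipartite_rel.
Proof. by case=> u [] v. Qed.

Lemma complete_bipartite_rel_irrefl : irreflexive complete_bipartite_rel.
Proof. by case. Qed.

Definition complete_bipartite : sgraph :=
  SGraph complete_bipartite_rel_sym complete_bipartite_rel_irrefl.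

End CompleteBipartite.

Definition bijectiveb (A B : finType) (f : {ffun A -> B}) : bool :=
  injectiveb f && [forall y, y \in codom f].

Lemma bijectivebP (A B : finType) (f : {ffun A -> B}) :
  reflect (bijective f) (bijectiveb f).
Proof.
apply: (iffP andP) => [[/injectiveP f_inj /forallP f_surj]|[g fK gK]].
  exists (fun y => iinv (f_surj y)) => [x|y]; last exact: f_iinv.
  by apply: f_inj; rewrite f_iinv.
split; first by apply/injectiveP; exact: can_inj fK.
by apply/forallP => y; rewrite -[y]gK codom_f.
Qed.

Section FriendsAndStrangers.
Variables X Y : sgraph.

Definition fs_vertex : finType := {f : {ffun X -> Y} | bijectiveb f}.

Definition fs_rel : rel fs_vertex := fun s t =>
  [exists a : X, exists b : X,
    [&& sedge a b, sedge (val s a) (val s b),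
        val s a == val t b, val s b == val t a &
        [forall c : X, (c != a) && (c != b) ==> (val s c == val t c)]]].

Lemma fs_rel_sym : symmetric fs_rel.
Proof.
suff imp s t : fs_rel s t -> fs_rel t s by move=> s t; apply/idP/idP; exact: imp.
case/existsP=> a /existsP[b /and5P[ab sab /eqP sa /eqP sb /forallP sc]].
apply/existsP; exists a; apply/existsP; exists b.
rewrite ab -sa -sb sedge_sym sab !eqxx /=.
by apply/forallP => c; rewrite [val t c == _]eq_sym; exact: sc.
Qed.

Lemma fs_rel_irrefl : irreflexive fs_rel.
Proof.
move=> s; apply/existsP => -[a /existsP[b /and5P[_ sab /eqP sa _ _]]].
by rewrite sa sedge_irrefl in sab.
Qed.

Definition friends_strangers : sgraph := SGraph fs_rel_sym fs_rel_irrefl.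

End FriendsAndStrangers.

(* Main.v *)
Require Import Defs.
From mathcomp Require Import all_boot all_fingroup zify.

(* Read FS(K_{2,n-2}, Y) as a sliding puzzle on Y: the two vertices of the small
   part are blanks P and Q, the others are tokens, and a move slides a token along
   an edge into a blank.  A state is a permutation s of Y, sending each token
   (named by a vertex of Y) to its position.

   Sufficiency.  Up to exchanging the two blanks, all arrangements on a claw are
   reachable from one another.  This property spreads from a set S to S + w when
   some u in S is adjacent to w: either u has two neighbours in S, and then w is a
   leaf of a claw centred at u; or its only neighbour u1 in S is such that u u1 is
   not a cut edge, so that an ear leaves S at u and returns elsewhere, and a blank
   walking along the ear brings the outer token into S.  Hence any two states are
   connected up to the exchange of the blanks.  If that exchange itself is not
   realizable, then "being connected to a fixed state" corrected by the sign of the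
   permutation depends only on the pair of positions of the blanks and changes at
   every move, which makes Y bipartite.  A claw exists, since a connected
   non-bipartite graph of maximal degree 2 is a cycle.

   Necessity.  Each forbidden feature comes with an invariant of the puzzle: the
   component of a blank, the sign of s times the colours of the blanks, the side of
   the cut edge on which a token is trapped, the cyclic order of three tokens. *)

Set Implicit Arguments.
Unset Strict Implicit.
Unset Printing Implicit Defensive.

(** * Conjugation identities for transpositions *)

Lemma tperm_mull (T : finType) (s : {perm T}) (a b : T) :
  (tperm a b * s = s * tperm (s a) (s b))%g.
Proof. by rewrite conjgC tpermJ. Qed.

Lemma tperm_mulr (T : finType) (s : {perm T}) (x y : T) :
  (s * tperm x y = tperm (s^-1 x) (s^-1 y) * s)%g.
Proof. by rewrite tperm_mull !permKV. Qed.

Lemma tperm_triangle (T : finType) (a b c : T) : a != c -> b != c ->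
  (tperm a c = tperm a b * (tperm b c * tperm a b))%g.
Proof.
move=> ac bc; rewrite -{1}[tperm a b]tpermV -[RHS]/(tperm b c ^ tperm a b)%g.
by rewrite tpermJ tpermR tpermD.
Qed.

(** * Moves and exchangeable tokens *)

Section Puzzle.
Local Open Scope group_scope.
Variables (G : sgraph) (P Q : G).
Hypothesis PQ : P != Q.
Implicit Types (s : {perm G}) (S : {set G}).

Definition blank (t : G) := (t == P) || (t == Q).

(** Products act from left to right: [tperm a b * s] exchanges the tokens [a] and [b], whereas
    [s * tperm x y] exchanges the contents of the positions [x] and [y]. The condition
    [blank a != blank b] is adjacency in the complete bipartite graph. *)
Definition slide : rel {perm G} := fun s s' =>
  [exists a, exists b,
    [&& blank a != blank b, sedge (s a) (s b) & s' == tperm a b * s]].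

(** The blanks may also be exchanged for free, wherever they stand, so that [reach] is connectedness
    up to that exchange. *)
Definition uslide : rel {perm G} := fun s s' =>
  slide s s' || (s' == tperm P Q * s).

Definition reach := connect uslide.

Lemma slideP s s' :
  reflect (exists a b, [/\ blank a != blank b, sedge (s a) (s b)
                         & s' = tperm a b * s]) (slide s s').
Proof.
apply: (iffP existsP) => [[a /existsP[b /and3P[? ? /eqP ?]]]|[a [b [? ? ->]]]].
  by exists a, b.
by exists a; apply/existsP; exists b; apply/and3P.
Qed.

Lemma slide_sym : symmetric slide.
Proof.
suff imp s s' : slide s s' -> slide s' s by move=> s s'; apply/idP/idP; apply: imp.
case/slideP=> a [b [ab e ->]]; apply/slideP; exists a, b; split=> //.
  by rewrite !permM tpermL tpermR sedge_sym.
by rewrite mulgA tperm2 mul1g.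
Qed.

Lemma slide_connect_sym : connect_sym slide.
Proof. exact: sym_connect_sym slide_sym. Qed.

Lemma reach_sym : connect_sym uslide.
Proof.
apply: sym_connect_sym => s s'; rewrite /uslide slide_sym; congr (_ || _).
by apply/eqP/eqP => ->; rewrite mulgA tperm2 mul1g.
Qed.

Lemma reach_refl s : reach s s. Proof. exact: connect0. Qed.

Lemma reach_trans s2 s1 s3 : reach s1 s2 -> reach s2 s3 -> reach s1 s3.
Proof. exact: connect_trans. Qed.

(** Left multiplication only renames tokens, and [r] renames blanks to blanks; positions, hence
    edges, are untouched. *)
Lemma slide_left (r : {perm G}) s s' :
  (forall t, blank (r t) = blank t) -> slide s s' -> slide (r * s) (r * s').
Proof.
move=> rB /slideP[a [b [ab e ->]]]; apply/slideP; exists (r^-1 a), (r^-1 b).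
split; first by rewrite -[blank (r^-1 a)]rB -[blank (r^-1 b)]rB !permKV.
  by rewrite !permM !permKV.
by rewrite !mulgA tperm_mulr.
Qed.

Lemma slide_connect_left (r : {perm G}) s s' :
  (forall t, blank (r t) = blank t) ->
  connect slide s s' -> connect slide (r * s) (r * s').
Proof.
move=> rB /connectP[p + ->]; elim: p s => [|s1 p IH] s /=; first by rewrite connect0.
by case/andP=> /(slide_left rB)/connect1/connect_trans h /IH; apply: h.
Qed.

Lemma blank_tperm a b : blank a = blank b -> forall t, blank (tperm a b t) = blank t.
Proof. by move=> ab t; case: tpermP => // ->. Qed.

Lemma blankP : blank P. Proof. by rewrite /blank eqxx. Qed.
Lemma blankQ : blank Q. Proof. by rewrite /blank eqxx orbT. Qed.

Lemma blank_tpermPQ t : blank (tperm P Q t) = blank t.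
Proof. by apply: blank_tperm; rewrite blankP blankQ. Qed.

Lemma left_tpermPQ (r : {perm G}) : (forall t, blank (r t) = blank t) ->
  r * tperm P Q = tperm P Q * r.
Proof.
move=> rB; rewrite tperm_mull.
have rPQ : r P != r Q by rewrite (inj_eq (@perm_inj _ r)).
have := rB P; have := rB Q; rewrite blankP blankQ.
move=> /orP[]/eqP rQ /orP[]/eqP rP; rewrite rP rQ ?eqxx // in rPQ *.
by rewrite tpermC.
Qed.

Lemma reach_left (r : {perm G}) s s' : (forall t, blank (r t) = blank t) ->
  reach s s' -> reach (r * s) (r * s').
Proof.
move=> rB /connectP[p + ->]; elim: p s => [|s1 p IH] s /=; first by rewrite reach_refl.
case/andP=> ss1 /IH; apply: reach_trans; apply: connect1.
case/orP: ss1 => [/(slide_left rB)|/eqP ->]; rewrite /uslide; first by move->.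
by rewrite !mulgA left_tpermPQ // eqxx orbT.
Qed.

(** If [b] is a blank too, the transposition is [tperm P Q], a free move. *)
Lemma reach_blank s a b :
  blank a -> sedge (s a) (s b) -> reach s (tperm a b * s).
Proof.
move=> a_bl e; apply: connect1; rewrite /uslide.
have [b_bl|nb_bl] := boolP (blank b); last first.
  by apply/orP; left; apply/slideP; exists a, b; rewrite a_bl (negPf nb_bl).
have ab : a != b by apply: contraTneq e => ->; rewrite sedge_irrefl.
suff -> : tperm a b = tperm P Q by rewrite eqxx orbT.
by case/orP: a_bl ab => /eqP->; case/orP: b_bl => /eqP->; rewrite ?eqxx // tpermC.
Qed.

Lemma reach_blankr s x y :
  blank (s^-1 x) || blank (s^-1 y) -> sedge x y -> reach s (s * tperm x y).
Proof.
move=> /orP[] h e; last rewrite tpermC; rewrite tperm_mulr; apply: reach_blank => //;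
  by rewrite !permKV // sedge_sym.
Qed.

(** * Exchanging two tokens *)

Definition exch s A B := reach s (tperm A B * s).

Lemma exch_sym s A B : exch s A B = exch s B A.
Proof. by rewrite /exch tpermC. Qed.

Lemma exch_refl s A : exch s A A.
Proof. by rewrite /exch tperm1 mul1g reach_refl. Qed.

(** Go back to [s], exchange there, then follow the same path to [s'] with [A] and [B] renamed. *)
Lemma exch_reach s s' A B : ~~ blank A -> ~~ blank B ->
  reach s s' -> exch s A B -> exch s' A B.
Proof.
move=> nA nB ss' h; apply: (@reach_trans s); first by rewrite /reach reach_sym.
apply: (reach_trans h); apply: reach_left ss'.
by apply: blank_tperm; rewrite (negPf nA) (negPf nB).
Qed.

(** By [tperm_triangle], (A C) is the product (A B)(B C)(A B); each factor is realized after
    renaming the tokens by the preceding ones. *)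
Lemma exch_trans s A B C : ~~ blank A -> ~~ blank B -> ~~ blank C ->
  exch s A B -> exch s B C -> exch s A C.
Proof.
move=> nA nB nC hAB hBC.
have [->|AB] := eqVneq A B; first by [].
have [<-|BC] := eqVneq B C; first by [].
have [->|AC] := eqVneq A C; first exact: exch_refl.
have -> : exch s A C = reach s (tperm A B * (tperm B C * (tperm A B * s))).
  by rewrite /exch (tperm_triangle AC BC) !mulgA.
have tB X Y : ~~ blank X -> ~~ blank Y -> forall t, blank (tperm X Y t) = blank t.
  by move=> /negPf nX /negPf nY; apply: blank_tperm; rewrite nX nY.
apply: (reach_trans hAB); apply: reach_left; first exact: tB.
by apply: (reach_trans hBC); apply: reach_left; first exact: tB.
Qed.

(** * Good sets of positions *)

Definition blanks_in S s := (s P \in S) && (s Q \in S).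

Definition in_rel S : rel G := fun x y => [&& x \in S, y \in S & sedge x y].

Definition spanned S := {in S &, forall x y, connect (in_rel S) x y}.

Definition good S :=
  forall s, blanks_in S s -> {in S &, forall x y, reach s (s * tperm x y)}.

Lemma blanks_in_tperm S s x y : x \in S -> y \in S ->
  blanks_in S (s * tperm x y) = blanks_in S s.
Proof.
move=> xS yS; rewrite /blanks_in !permM.
by congr (_ && _); case: tpermP => [->|->|//]; rewrite xS yS.
Qed.

Lemma blanks_inP S s t : blank t -> blanks_in S s -> s t \in S.
Proof. by case/orP=> /eqP-> /andP[]. Qed.

Lemma good_trans S x y z : x \in S -> y \in S -> z \in S ->
  (forall s, blanks_in S s -> reach s (s * tperm x y)) ->
  (forall s, blanks_in S s -> reach s (s * tperm y z)) ->
  (forall s, blanks_in S s -> reach s (s * tperm x z)).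
Proof.
move=> xS yS zS hxy hyz s sS.
have [->|xy] := eqVneq x y; first exact: hyz.
have [<-|yz] := eqVneq y z; first exact: hxy.
have [->|xz] := eqVneq x z; first by rewrite tperm1 mulg1 reach_refl.
rewrite (tperm_triangle xz yz) !mulgA; apply: (reach_trans (hxy _ sS)).
apply: (reach_trans (hyz _ _)); first by rewrite blanks_in_tperm.
by apply: hxy; rewrite !blanks_in_tperm.
Qed.

(** Transpositions along the edges of a connected graph yield all transpositions. An edge with a
    blank at an end is itself a move, so only edges between two tokens require a hypothesis. *)
Lemma good_edges S : spanned S ->
  (forall s A B, blanks_in S s -> ~~ blank A -> ~~ blank B ->
     s A \in S -> s B \in S -> sedge (s A) (s B) -> exch s A B) ->
  good S.
Proof.
move=> spS h.
have step x y s : in_rel S x y -> blanks_in S s -> reach s (s * tperm x y).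
  case/and3P=> xS yS xy sS.
  have [bl|] := boolP (blank (s^-1 x) || blank (s^-1 y)).
    exact: reach_blankr.
  rewrite negb_or tperm_mulr => /andP[nx ny].
  by apply: h; rewrite ?permKV.
suff gen x y : connect (in_rel S) x y -> x \in S ->
    y \in S /\ forall s, blanks_in S s -> reach s (s * tperm x y).
  by move=> s sS x y xS yS; apply: (gen x y (spS _ _ xS yS) xS).2.
case/connectP=> p + ->; elim: p x => [|z p IH] x /=.
  by move=> _ xS; split=> // s _; rewrite tperm1 mulg1 reach_refl.
case/andP=> xz pz xS; have zS : z \in S by case/and3P: xz.
have [lS hl] := IH _ pz zS; split=> //.
by apply: (good_trans xS zS lS _ hl) => s; apply: step.
Qed.

Lemma blanks_in_forall S s :
  reflect (forall t, blank t -> s t \in S) (blanks_in S s).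
Proof.
apply: (iffP idP) => [sS t bt|h]; first exact: blanks_inP.
by rewrite /blanks_in !h ?blankP ?blankQ.
Qed.

Lemma blank_two a b c : blank a -> blank b -> blank c -> a != b -> (c == a) || (c == b).
Proof.
by move=> /orP[]/eqP-> /orP[]/eqP->; rewrite ?eqxx // /blank // orbC.
Qed.

Lemma good_exch S s A B : good S -> blanks_in S s ->
  s A \in S -> s B \in S -> exch s A B.
Proof. by move=> gS sS AS BS; rewrite /exch tperm_mull; apply: gS. Qed.

(** Two transpositions inside [S] bring the blanks to [a] and [b], so nothing outside [S] moves. *)
Lemma good_move S s a b : good S -> blanks_in S s -> a \in S -> b \in S -> a != b ->
  exists s', [/\ reach s s', s' P = a, s' Q = b & forall t, s t \notin S -> s' t = s t].
Proof.
move=> gS sS aS bS ab; pose s1 := s * tperm (s P) a.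
have PS : s P \in S by case/andP: sS.
have s1S : blanks_in S s1 by rewrite blanks_in_tperm.
have QS : s1 Q \in S by case/andP: s1S.
have s1P : s1 P = a by rewrite permM tpermL.
exists (s1 * tperm (s1 Q) b); split.
- by apply: (reach_trans (gS _ sS _ _ PS aS)); apply: gS.
- rewrite permM tpermD ?s1P // 1?eq_sym //.
  by rewrite -s1P (inj_eq perm_inj) PQ.
- by rewrite permM tpermL.
move=> t tS; have s1t : s1 t = s t.
  by rewrite permM tpermD //; apply: contraNneq tS => <-.
by rewrite permM s1t tpermD //; apply: contraNneq tS => <-.
Qed.

Lemma spanned_extend S u w : spanned S -> u \in S -> sedge u w -> spanned (w |: S).
Proof.
move=> spS uS uw.
have sub x y : x \in S -> y \in S -> connect (in_rel (w |: S)) x y.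
  move=> xS yS; apply: connect_sub (spS _ _ xS yS) => {x y xS yS} x y /and3P[xS yS xy].
  by apply: connect1; rewrite /in_rel !inE xS yS xy !orbT.
have uw1 : connect (in_rel (w |: S)) u w.
  by apply: connect1; rewrite /in_rel !inE uS uw eqxx orbT.
have wu1 : connect (in_rel (w |: S)) w u.
  by apply: connect1; rewrite /in_rel !inE uS sedge_sym uw eqxx orbT.
move=> x y /setU1P[->|xS] /setU1P[->|yS]; first exact: connect0.
- exact: connect_trans wu1 (sub _ _ uS yS).
- exact: connect_trans (sub _ _ xS uS) uw1.
- exact: sub.
Qed.

(** A blank at [w] steps back to [u]; if the other blank occupies [u], it first makes way by moving
    to [u1]. *)
Lemma blanks_retract S u u1 w s : u \in S -> u1 \in S -> w \notin S ->
  sedge u w -> sedge u u1 -> blanks_in (w |: S) s ->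
  exists s', [/\ reach s s', blanks_in S s'
               & forall t, (s' t \in w |: S) = (s t \in w |: S)].
Proof.
move=> uS u1S wS uw uu1.
have uS' : u \in w |: S by rewrite !inE uS orbT.
have u1S' : u1 \in w |: S by rewrite !inE u1S orbT.
have wS' : w \in w |: S by rewrite !inE eqxx.
have inv s1 x y t : x \in w |: S -> y \in w |: S ->
    ((s1 * tperm x y) t \in w |: S) = (s1 t \in w |: S).
  by move=> xS yS; rewrite permM; case: tpermP => [->|->|//]; rewrite xS yS.
move=> sS.
have [sS1|nsS] := boolP (blanks_in S s); first by exists s; split=> //; apply: reach_refl.
have bw : blank (s^-1 w).
  apply: contraR nsS => nw; apply/blanks_in_forall => t bt.
  have := blanks_inP bt sS; rewrite !inE; case/orP=> // /eqP tw.
  by case/negP: nw; rewrite -tw permK.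
have main s1 : blank (s1^-1 w) -> ~~ blank (s1^-1 u) -> blanks_in (w |: S) s1 ->
    reach s1 (s1 * tperm w u) /\ blanks_in S (s1 * tperm w u).
  move=> b1 nu s1S; split; first by apply: reach_blankr; rewrite ?b1 // sedge_sym.
  apply/blanks_in_forall => t bt; rewrite permM.
  case: tpermP => [_ //|tu|/eqP tw _].
    by case/negP: nu; rewrite -tu permK.
  by have := blanks_inP bt s1S; rewrite !inE (negPf tw).
have [bu|nbu] := boolP (blank (s^-1 u)); last first.
  have [r1 r2] := main s bw nbu sS.
  by exists (s * tperm w u); split=> // t; apply: inv.
have wu : w != u by apply: contraNneq wS => ->.
have wu1 : w != u1 by apply: contraNneq wS => ->.
have neuu1 : u != u1 by apply: contraTneq uu1 => ->; rewrite sedge_irrefl.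
have nbu1 : ~~ blank (s^-1 u1).
  apply/negP=> bu1; have := blank_two bw bu bu1.
  by rewrite !(inj_eq perm_inj) wu [u1 == w]eq_sym [u1 == u]eq_sym (negPf wu1) (negPf neuu1) => /(_ isT).
pose s1 := s * tperm u u1.
have r0 : reach s s1 by apply: reach_blankr; rewrite ?bu.
have b1w : blank (s1^-1 w) by rewrite invMg tpermV permM tpermD // eq_sym.
have b1u : ~~ blank (s1^-1 u) by rewrite invMg tpermV permM tpermL.
have s1S : blanks_in (w |: S) s1 by rewrite blanks_in_tperm.
have [r1 r2] := main s1 b1w b1u s1S.
exists (s1 * tperm w u); split=> //; first exact: reach_trans r0 r1.
by move=> t; rewrite !inv.
Qed.

(** Once both blanks are in [S], goodness exchanges any two tokens of [S], so by transitivity a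
    single exchange between the token at [w] and some token of [S] suffices. *)
Lemma good_extend S u u1 w : good S -> spanned S ->
  u \in S -> u1 \in S -> w \notin S -> sedge u w -> sedge u u1 ->
  (forall s A, blanks_in S s -> s A = w ->
     exists D, [/\ ~~ blank D, s D \in S & exch s A D]) ->
  good (w |: S).
Proof.
move=> gS spS uS u1S wS uw uu1 h.
apply: good_edges; first exact: spanned_extend spS uS uw.
move=> s A B sS nA nB AS BS _.
have [s1 [r s1S eqS]] := blanks_retract uS u1S wS uw uu1 sS.
suff : exch s1 A B by apply: exch_reach => //; rewrite /reach reach_sym.
move: AS BS; rewrite -!eqS => AS BS {eqS r sS s}.
have wl C D : ~~ blank C -> ~~ blank D -> s1 C = w -> s1 D \in S -> exch s1 C D.
  move=> nC nD Cw DS; have [E [nE ES]] := h _ _ s1S Cw.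
  by move=> /exch_trans; apply=> //; apply: (good_exch gS).
case/setU1P: AS => [Aw|AS]; case/setU1P: BS => [Bw|BS].
- by rewrite (perm_inj (etrans Aw (esym Bw))) exch_refl.
- exact: wl.
- by rewrite exch_sym; apply: wl.
- exact: good_exch gS _ _ _.
Qed.

(* Two blanks on the leaves y, z of a claw let the tokens at v and x trade
   places, at the price of swapping the blanks too. *)
Lemma claw_slide s v x y z :
  uniq [:: v; x; y; z] -> sedge v x -> sedge v y -> sedge v z ->
  blank (s^-1 y) -> blank (s^-1 z) ->
  connect slide s (s * tperm v x * tperm y z).
Proof.
rewrite /= !inE !negb_or !andbT => /and3P[/and3P[vx vy vz] /andP[xy xz] yz].
move=> evx evy evz byy bz.
have sl s1 a b : blank (s1^-1 a) != blank (s1^-1 b) -> sedge a b ->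
    connect slide s1 (s1 * tperm a b).
  move=> ab e; apply: connect1; apply/slideP; exists (s1^-1 a), (s1^-1 b).
  by rewrite !permKV tperm_mulr.
have no t : t != y -> t != z -> blank (s^-1 t) = false.
  move=> ty tz; apply: contraNF ty => bt.
  by have := blank_two byy bz bt; rewrite !(inj_eq perm_inj) yz (negPf tz) orbF => /(_ isT).
have bv : blank (s^-1 v) = false by apply: no.
have bx : blank (s^-1 x) = false by apply: no.
have tE a b t : tperm a b t = if t == a then b else if t == b then a else t.
  case: tpermP => [->|->|/eqP ta /eqP tb]; rewrite ?eqxx ?(negPf ta) ?(negPf tb) //.
  by case: eqVneq.
have neqs := (negPf vx, negPf vy, negPf vz, negPf xy, negPf xz, negPf yz).
have neqs' := (eq_sym x v, eq_sym y v, eq_sym z v, eq_sym y x, eq_sym z x, eq_sym z y).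
(* The blank at [y] goes through [v] to [x]; the token of [x] parks at [z] while the blank there
   passes to [y]; the first blank then returns through [v] and ends at [z]. *)
have -> : s * tperm v x * tperm y z =
    s * tperm v y * tperm v x * tperm v z * tperm v y * tperm v x * tperm v z.
  rewrite -!mulgA; congr (_ * _); apply/permP => t; rewrite !permM !tE.
  have [te|tv] := eqVneq t v; first by do !rewrite ?te ?eqxx ?neqs' ?neqs /=.
  have [te|tx] := eqVneq t x; first by do !rewrite ?te ?eqxx ?neqs' ?neqs /=.
  have [te|ty] := eqVneq t y; first by do !rewrite ?te ?eqxx ?neqs' ?neqs /=.
  have [te|tz] := eqVneq t z; first by do !rewrite ?te ?eqxx ?neqs' ?neqs /=.
  by do !rewrite ?(negPf tv) ?(negPf tx) ?(negPf ty) ?(negPf tz).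
have bl := (bv, bx, byy, bz).
have slR s1 a b : connect slide s s1 -> blank (s1^-1 a) != blank (s1^-1 b) ->
    sedge a b -> connect slide s (s1 * tperm a b).
  by move=> ss1 ab eab; apply: connect_trans ss1 (sl _ _ _ ab eab).
do ?apply: (slR) => //; rewrite ?connect0 // ?invMg ?tpermV ?permM.
all: by do !rewrite ?tE ?eqxx ?neqs' ?neqs ?bl /=.
Qed.

Lemma blank_inv s x : blank (s^-1 x) = (x == s P) || (x == s Q).
Proof.
by congr (_ || _); apply/eqP/eqP => [<-|->]; rewrite ?permKV ?permK.
Qed.

Lemma tperm_blanks s y z : blank (s^-1 y) -> blank (s^-1 z) -> y != z ->
  s * tperm y z = tperm P Q * s.
Proof.
rewrite tperm_mulr -(inj_eq (@perm_inj _ s^-1)) => by1 bz1.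
by case/orP: by1 => /eqP->; case/orP: bz1 => /eqP->; rewrite ?eqxx // tpermC.
Qed.

Lemma reach_slide s s' : connect slide s s' -> reach s s'.
Proof.
by apply: connect_sub => x y xy; apply: connect1; rewrite /uslide xy.
Qed.

Lemma reach_tpermPQ s : reach s (tperm P Q * s).
Proof. by apply: connect1; rewrite /uslide eqxx orbT. Qed.

(** The exchange of the blanks left over by [claw_slide] is undone by a free move. *)
Lemma claw_reach s v x y z :
  uniq [:: v; x; y; z] -> sedge v x -> sedge v y -> sedge v z ->
  blank (s^-1 y) -> blank (s^-1 z) -> reach s (s * tperm v x).
Proof.
move=> u4 vx vy vz b1 b2; apply: reach_trans (reach_slide _) _.
  exact: claw_slide u4 vx vy vz b1 b2.
move: u4; rewrite /= !inE !negb_or => /and4P[/and3P[_ ? ?] /andP[? ?] yz _].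
rewrite tperm_blanks // ?invMg ?tpermV ?permM ?tpermD //.
by rewrite /reach reach_sym; apply: reach_tpermPQ.
Qed.

(** If neither the centre nor a given leaf holds a blank, both blanks are on the other two leaves
    and [claw_reach] applies. Transpositions with the centre then generate all others. *)
Lemma claw_good v x y z :
  uniq [:: v; x; y; z] -> sedge v x -> sedge v y -> sedge v z ->
  good [set v; x; y; z].
Proof.
set S := [set v; x; y; z] => u4 vx vy vz.
have leaf a b c s : {subset S <= [:: v; a; b; c]} -> uniq [:: v; a; b; c] ->
    sedge v a -> sedge v b -> sedge v c ->
    blanks_in S s -> reach s (s * tperm v a).
  move=> sub u4' va vb vc /andP[PS QS].
  have [bl|] := boolP (blank (s^-1 v) || blank (s^-1 a)); first exact: reach_blankr.
  rewrite negb_or => /andP[nv na].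
  have bc t : blank t -> s t \in S -> (s t == b) || (s t == c).
    move=> bt /sub; rewrite !inE => /or4P[]/eqP h.
    - by rewrite -h permK bt in nv.
    - by rewrite -h permK bt in na.
    - by rewrite h eqxx.
    - by rewrite h eqxx orbT.
  have sPQ : s P != s Q by rewrite (inj_eq perm_inj).
  have [bb bbc] : blank (s^-1 b) /\ blank (s^-1 c).
    case/orP: (bc _ blankP PS) => /eqP hP; case/orP: (bc _ blankQ QS) => /eqP hQ;
      by rewrite -?hP -?hQ ?permK ?blankP ?blankQ // hP hQ eqxx in sPQ *.
  exact: claw_reach u4' va vb vc bb bbc.
have star a : a \in S -> forall s, blanks_in S s -> reach s (s * tperm v a).
  move: u4; rewrite /= !inE !negb_or => /and4P[/and3P[? ? ?] /andP[? ?] ? _].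
  rewrite -!orbA => /or4P[]/eqP-> s.
  - by rewrite tperm1 mulg1 reach_refl.
  - apply: (leaf x y z) => //.
      by move=> t; rewrite !inE -!orbA.
    by rewrite /= !inE !negb_or; do !(apply/andP; split).
  - apply: (leaf y x z) => //.
      by move=> t; rewrite !inE -!orbA => /or4P[]->; rewrite ?orbT.
    by rewrite /= !inE !negb_or; do !(apply/andP; split); rewrite // eq_sym.
  - apply: (leaf z x y) => //.
      by move=> t; rewrite !inE -!orbA => /or4P[]->; rewrite ?orbT.
    by rewrite /= !inE !negb_or; do !(apply/andP; split); rewrite // eq_sym.
have vS : v \in S by rewrite !inE eqxx.
move=> s sS a b aS bS; apply: (good_trans aS vS bS) sS; last exact: star.
by move=> s' s'S; rewrite tpermC; apply: star.
Qed.

Lemma claw_spanned v x y z :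
  sedge v x -> sedge v y -> sedge v z -> spanned [set v; x; y; z].
Proof.
set S := [set _; _; _; _] => vx vy vz.
have vS : v \in S by rewrite !inE eqxx.
have vt t : t \in S -> connect (in_rel S) v t.
  move=> tS; have [->|tv] := eqVneq t v; first exact: connect0.
  apply: connect1; rewrite /in_rel vS tS.
  by move: tS tv; rewrite !inE -!orbA => /or4P[]/eqP-> //; rewrite eqxx.
have sym : connect_sym (in_rel S).
  by apply: sym_connect_sym => a b; rewrite /in_rel andbCA sedge_sym.
move=> a b aS bS; apply: connect_trans (vt b bS).
by rewrite sym vt.
Qed.

(** If the walk meets [Q], the two blanks trade places, which is free. *)
Lemma reach_walk s p : path (@sedge G) (s P) p ->
  exists s', [/\ reach s s', s' P = last (s P) p
               & forall t, s t \notin s P :: p -> s' t = s t].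
Proof.
elim: p s => [|y p IH] s /=; first by exists s; split=> //; apply: reach_refl.
case/andP=> e yp; pose s1 := s * tperm (s P) y.
have s1P : s1 P = y by rewrite permM tpermL.
have [|s' [r l h]] := IH s1; first by rewrite s1P.
exists s'; split; last 1 first.
- move=> t; rewrite !inE !negb_or => /and3P[tP ty tp].
  have s1t : s1 t = s t by rewrite permM tpermD // eq_sym.
  by rewrite h s1t // s1P inE negb_or ty.
- apply: reach_trans r; apply: reach_blankr => //.
  by rewrite permK blankP.
- by rewrite l s1P.
Qed.

(** With the blanks placed on [u1] and [u2], the tokens at [u] and [w] sit at the centre and the
    third leaf of a claw; [D] is the token then found at [u]. *)
Lemma claw_exch S u u1 u2 w s A : good S -> u \in S -> u1 \in S -> u2 \in S ->
  w \notin S -> u1 != u2 -> sedge u w -> sedge u u1 -> sedge u u2 ->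
  blanks_in S s -> s A = w -> exists D, [/\ ~~ blank D, s D \in S & exch s A D].
Proof.
move=> gS uS u1S u2S wS u12 uw uu1 uu2 sS Aw.
have [s0 [r0 sP sQ s0E]] := good_move gS sS u1S u2S u12.
have s0A : s0 A = w by rewrite s0E Aw.
have nA : ~~ blank A by apply/negP => /blanks_inP-/(_ _ _ sS); rewrite Aw (negPf wS).
have uu1N : u1 != u by apply: contraTneq uu1 => ->; rewrite sedge_irrefl.
have uu2N : u2 != u by apply: contraTneq uu2 => ->; rewrite sedge_irrefl.
have nD : ~~ blank (s0^-1 u).
  by rewrite blank_inv sP sQ negb_or ![u == _]eq_sym uu1N.
exists (s0^-1 u); split=> //.
  (* The tokens that [s] puts outside [S] have not moved, so a token that [s0] puts in [S] was
     already there. *)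
  by apply: contraT => /[dup]/s0E <-; rewrite permKV uS.
apply: (@exch_reach s0) => //; first by rewrite /reach reach_sym.
rewrite /exch tperm_mull permKV s0A tpermC.
apply: (@claw_reach _ _ _ u1 u2) => //; last 2 first.
- by rewrite -sP permK blankP.
- by rewrite -sQ permK blankQ.
rewrite /= !inE !negb_or u12 ![u == _]eq_sym uu1N uu2N !andbT /=.
by apply/and3P; split; apply: contraNneq wS => h; rewrite ?h // -h.
Qed.

(* Walking a blank from u along the ear to v pushes the token at w into S,
   without touching the token at a fourth vertex d of S. *)
Lemma ear_exch S u w p s A : good S -> 3 < #|S| -> u \in S -> w \notin S ->
  sedge u w -> path (@sedge G) w p -> last w p \in S -> last w p != u ->
  {in w :: p, forall t, t \in S -> t = last w p} ->
  blanks_in S s -> s A = w -> exists D, [/\ ~~ blank D, s D \in S & exch s A D].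
Proof.
move=> gS S4 uS wS uw wp vS; set v := last w p in vS * => vu pS sS Aw.
have : 1 < #|S :\ u :\ v|.
  by move: S4; rewrite (cardsD1 u) uS (cardsD1 v) !inE vu vS.
(* Two vertices of [S] remain besides [u] and [v], both off the ear: [c] will hold the blank [Q] and
   [d] the token [D]. *)
case/card_gt1P=> c [d []]; rewrite !inE => /and3P[cv cu cS] /and3P[dv du dS] cd.
have [|s0 [r0 sP sQ s0E]] := good_move gS sS uS cS; first by rewrite eq_sym.
have s0A : s0 A = w by rewrite s0E Aw.
have nA : ~~ blank A by apply/negP => /blanks_inP-/(_ _ _ sS); rewrite Aw (negPf wS).
pose D := s0^-1 d; have s0D : s0 D = d by rewrite permKV.
have nD : ~~ blank D.
  by rewrite blank_inv sP sQ negb_or du eq_sym cd.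
have notin t : t \in S -> t != v -> t \notin w :: p.
  by move=> tS; apply: contraNN => /pS ->.
(* Sliding [P] from [u] to [w] pulls the token [A] back to [u], which the rest of the walk
   avoids. *)
pose s1 := s0 * tperm u w.
have s1P : s1 P = w by rewrite permM sP tpermL.
have s1A : s1 A = u by rewrite permM s0A tpermR.
have wN t : t \in S -> w != t by apply: contraTneq => <-.
have s1Q : s1 Q = c by rewrite permM sQ tpermD ?wN // eq_sym.
have s1D : s1 D = d by rewrite permM s0D tpermD ?wN // eq_sym.
have [|s2 [r2 s2P s2E]] := @reach_walk s1 p; first by rewrite s1P.
rewrite s1P -/v in s2P s2E.
have s2A : s2 A = u by rewrite s2E s1A // notin // eq_sym.
have s2Q : s2 Q = c by rewrite s2E s1Q // notin.
have s2D : s2 D = d by rewrite s2E s1D // notin.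
have s2S : blanks_in S s2 by rewrite /blanks_in s2P s2Q vS.
exists D; split=> //.
  by apply: contraT => /[dup]/s0E <-; rewrite s0D dS.
apply: (@exch_reach s2) => //; last by apply: (good_exch gS); rewrite ?s2A ?s2D.
rewrite /reach reach_sym; apply: (reach_trans r0); apply: reach_trans r2.
by apply: reach_blankr; rewrite // -sP permK blankP.
Qed.

End Puzzle.

(** * Growing a good set *)

(** The walk is cut at its first entry into [S]. *)
Lemma path_first_hit (T : finType) (e : rel T) (S : {set T}) w p :
  path e w p -> last w p \in S -> w \notin S ->
  exists p1, [/\ path e w p1, last w p1 \in S, {subset p1 <= p}
               & {in w :: p1, forall t, t \in S -> t = last w p1}].
Proof.
elim: p w => [|y p IH] w /=; first by move=> _ ->.
case/andP=> wy yp lS wS.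
have [yS|nyS] := boolP (y \in S).
  exists [:: y]; split=> //=; first by rewrite wy.
    by move=> t; rewrite !inE => ->.
  by move=> t; rewrite !inE => /orP[]/eqP->; rewrite ?(negPf wS).
have [p1 [h1 h2 h3 h4]] := IH y yp lS nyS.
exists (y :: p1); split=> //=; first by rewrite wy.
  by move=> t; rewrite !inE => /orP[->//|/h3->]; rewrite orbT.
by move=> t; rewrite inE => /orP[/eqP->|/h4 //]; rewrite (negPf wS).
Qed.

Lemma connect_leave (T : finType) (e : rel T) (S : {set T}) x y :
  connect e x y -> x \in S -> y \notin S ->
  exists u w, [/\ u \in S, w \notin S & e u w].
Proof.
case/connectP=> p + ->; elim: p x => [|z p IH] x /=; first by move=> _ ->.
case/andP=> xz zp xS lS; have [zS|nzS] := boolP (z \in S); first exact: (IH z).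
by exists x, z.
Qed.

Lemma degree_neq1 (G : sgraph) (x a b : G) :
  sedge x a -> sedge x b -> a != b -> degree x <> 1.
Proof.
move=> xa xb ab d1; have : 1 < degree x.
  by apply/card_gt1P; exists a, b; rewrite !inE xa xb ab.
by rewrite d1.
Qed.

Lemma no_cut_connect (G : sgraph) (a b : G) :
  ~ (exists a b : G, nontrivial_cut_edge a b) ->
  sedge a b -> degree a <> 1 -> degree b <> 1 -> connect (del_rel a b) a b.
Proof.
move=> ncut ab da db; have [//|nc] := boolP (connect (del_rel a b) a b).
case: ncut; exists a, b; split=> //; split=> // -[_ /(_ a b) h].
by case/negP: nc.
Qed.

Section Sufficiency.
Local Open Scope group_scope.
Variables (G : sgraph) (P Q : G).
Hypothesis PQ : P != Q.
Implicit Types (s : {perm G}) (S : {set G}).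

(** The vertex added need not be the [w] first found: when [u] has a single neighbour in [S], it is
    the first vertex of the ear. *)
Lemma good_grow S : connected_graph G ->
  ~ (exists a b : G, nontrivial_cut_edge a b) ->
  good P Q S -> spanned S -> 3 < #|S| -> S != setT ->
  exists w, [/\ w \notin S, good P Q (w |: S) & spanned (w |: S)].
Proof.
move=> [_ conG] ncut gS spS S4 SN.
have [a0 a0S] : exists a0, a0 \in S by apply/card_gt0P; apply: leq_trans S4.
have [b0 b0S] : exists b0, b0 \notin S.
  by move: SN; rewrite -subTset => /subsetPn[b0 _]; exists b0.
have [u [w [uS wS uw]]] := connect_leave (conG a0 b0) a0S b0S.
have other (x y : G) : exists z, [/\ z \in S, z != x & z != y].
  have : 0 < #|S :\ x :\ y|.
    move: S4; rewrite (cardsD1 x) (cardsD1 y (S :\ x)).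
    by case: #|S :\ x :\ y|; do 2!case: (_ \in _).
  by case/card_gt0P=> z; rewrite !inE => /and3P[? ? ?]; exists z.
have [z [zS zu _]] := other u u.
have span_path y : y \in S ->
    exists p, [/\ path (in_rel S) u p, uniq (u :: p) & last u p = y].
  move=> yS; have /connectP[p up ->] := spS _ _ uS yS.
  by case/shortenP: up => p' ? ? _; exists p'.
have [[|u1 p1] [/= up1 _ lz]] := span_path z zS; first by rewrite lz eqxx in zu.
case/andP: up1 => /and3P[_ u1S uu1] _.
case: (pickP [pred u2 | [&& u2 \in S, u2 != u1 & sedge u u2]]) => [u2|none].
  case/and3P=> u2S u21 uu2; exists w; split=> //; last exact: spanned_extend spS uS uw.
  apply: (good_extend PQ gS spS uS u1S wS uw uu1) => s A.
  by apply: (claw_exch PQ gS uS u1S u2S wS _ uw uu1 uu2); rewrite eq_sym.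
have sole y : y \in S -> sedge u y -> y = u1.
  by move=> yS uy; have := none y; rewrite /= yS uy andbT /= => /negbFE/eqP.
(* A simple path in [S] from [u] to a third vertex starts through [u1] and gives [u1] a neighbour
   [x2] other than [u]. Thus neither [u] nor [u1] has degree one. *)
have [y [yS yu yu1]] := other u u1.
have [[|x1 [|x2 p]] [/= up uq ly]] := span_path y yS.
- by rewrite ly eqxx in yu.
- case/andP: up => /and3P[_ x1S ux1] _.
  by rewrite -ly (sole _ x1S ux1) eqxx in yu1.
case/and3P: up => /and3P[_ x1S ux1] /and3P[_ _ x12] _.
have x1E := sole _ x1S ux1; rewrite {x1 x1S ux1}x1E in x12 uq ly.
have x2u : u != x2 by move: uq; rewrite !inE !negb_or; case/and3P=> /and3P[].
have du : degree u <> 1%N.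
  by apply: (degree_neq1 uu1 uw); apply: contraNneq wS => <-.
have du1 : degree u1 <> 1%N by apply: (degree_neq1 _ x12 x2u); rewrite sedge_sym.
have /connectP[q0 uq0 lq0] := no_cut_connect ncut uu1 du du1.
case/shortenP: uq0 lq0 => -[|w1 q] /= uq1 uqq _ lq.
  by rewrite lq sedge_irrefl in uu1.
case/andP: uq1 => /andP[uw1 ne] w1q.
(* The detour avoids the edge from [u] to [u1], the only edge from [u] into [S], so it leaves [S] at
   once. *)
have w1S : w1 \notin S.
  by apply: contraNN ne => w1S; rewrite (sole _ w1S uw1).
have w1q' : path (@sedge G) w1 q by apply: sub_path w1q => a b /andP[].
have [|q1 [wq1 vS q1q q1S]] := path_first_hit w1q' _ w1S; first by rewrite -lq.
exists w1; split=> //; last exact: spanned_extend spS uS uw1.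
apply: (good_extend PQ gS spS uS u1S w1S uw1 uu1) => s A.
apply: (ear_exch PQ gS S4 uS w1S uw1 wq1 vS) => //.
(* The detour is a simple path from [u], so the ear does not end at [u]. *)
apply: contraTneq uqq => <-; rewrite negb_and negbK.
have := mem_last w1 q1; rewrite !inE => /orP[->//|/q1q->]; by rewrite orbT.
Qed.

Lemma good_setT S : connected_graph G ->
  ~ (exists a b : G, nontrivial_cut_edge a b) ->
  good P Q S -> spanned S -> 3 < #|S| -> good P Q setT.
Proof.
move=> conG ncut; have [m] := ubnP #|~: S|; elim: m S => // m IH S Sm gS spS S4.
have [<- //|SN] := eqVneq S setT.
have [w [wS gw spw]] := good_grow conG ncut gS spS S4 SN.
apply: (IH (w |: S)) => //; last by rewrite cardsU1 wS; apply: leq_trans S4 _.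
move: Sm; rewrite (cardsD1 w) inE wS ltnS; apply: leq_ltn_trans.
by apply: subset_leq_card; apply/subsetP => t; rewrite !inE negb_or.
Qed.

(** [s^-1 * s'] is a product of transpositions of positions, each realized because [setT] is
    good. *)
Lemma reach_all s s' : good P Q setT -> reach P Q s s'.
Proof.
move=> gT; rewrite -(mulKVg s s'); have [ts -> _] := prod_tpermP (s^-1 * s').
elim: ts s => [|t ts IH] s; first by rewrite big_nil mulg1; apply: reach_refl.
rewrite big_cons mulgA; apply: reach_trans (IH _).
by apply: gT; rewrite /blanks_in ?inE.
Qed.

End Sufficiency.

(** * Exchanging the blanks *)

(** By induction, the image of [a] is corrected by a transposition that fixes the images already
    prescribed. *)
Lemma perm_of_seqs (T : finType) (s t : seq T) :
  size s = size t -> uniq s -> uniq t -> exists r : {perm T}, map r s = t.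
Proof.
elim: s t => [|a s IH] [|b t] //= => [_ _ _|[sz] /andP[aS us] /andP[bT ut]].
  by exists 1%g.
have [r rE] := IH t sz us ut; exists (r * tperm (r a) b)%g.
rewrite permM tpermL; congr (_ :: _); rewrite -rE; apply/eq_in_map => c cs.
rewrite permM tpermD //.
  by rewrite (inj_eq perm_inj); apply: contraNneq aS => ->.
by apply: contraNneq bT => ->; rewrite -rE map_f.
Qed.

Section Parity.
Local Open Scope group_scope.
Variables (G : sgraph) (P Q : G).
Hypothesis PQ : P != Q.
Hypothesis reachT : forall s s' : {perm G}, reach P Q s s'.
Implicit Types s : {perm G}.

Local Notation slides := (connect (slide P Q)).
Local Notation blank := (blank P Q).

(** Exchanging the blanks renames slides into slides, so the free exchanges along a path can be
    collected at its end, where they cancel in pairs. *)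
Lemma slides_or s s' : slides s s' \/ slides s (tperm P Q * s').
Proof.
have left u u' : slides u u' -> slides (tperm P Q * u) (tperm P Q * u').
  by apply: slide_connect_left => t; apply: blank_tpermPQ.
have /connectP[p + ->] := reachT s s'; elim: p s => [|s1 p IH] s /=; first by left.
case/andP=> /orP[/connect1 ss1|/eqP ->] /IH[] h; [left|right|right|left] => //.
- exact: connect_trans ss1 h.
- exact: connect_trans ss1 h.
- by move/left: h; rewrite mulgA tperm2 mul1g.
- by move/left: h; rewrite !mulgA tperm2 !mul1g.
Qed.

(** By [slides_or], every state is in the class of [s0] or in that of [tperm P Q * s0]; here the two
    coincide. *)
Lemma slides_all_of_swap s0 : slides s0 (tperm P Q * s0) -> forall s s', slides s s'.
Proof.
move=> h0; suff all s : slides s0 s.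
  move=> s s'; apply: connect_trans (all s').
  by rewrite slide_connect_sym.
case: (slides_or s0 s) => // h; apply: (connect_trans h0).
move: h => /(slide_connect_left (blank_tpermPQ P Q)).
by rewrite mulgA tperm2 mul1g.
Qed.

Section NoSwap.
Hypothesis no_swap : forall s, ~~ slides s (tperm P Q * s).
Variables v x y z : G.
Hypotheses (claw_uniq : uniq [:: v; x; y; z])
  (vx : sedge v x) (vy : sedge v y) (vz : sedge v z).

(** Under [no_swap] there are two classes of states. A slide keeps the class and changes the sign,
    while exchanging two tokens or the two blanks changes both, so [side] depends only on the pair
    of positions of the blanks. *)
Definition side s := slides 1 s (+) odd_perm s.

Lemma slides_congr s s' : slides s s' -> slides 1 s = slides 1 s'.
Proof.
move=> h; apply/idP/idP => h1; apply: connect_trans h1 _ => //.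
by rewrite slide_connect_sym.
Qed.

Lemma slides_swapPQ s : slides 1 (tperm P Q * s) = ~~ slides 1 s.
Proof.
have [h|h] := boolP (slides 1 s); last by case: (slides_or 1 s) h => [->|->].
apply: contraNF (no_swap s); apply: connect_trans.
by rewrite slide_connect_sym.
Qed.

(** [claw_slide] realizes [r] in one state, and renaming carries this to every state, since [r]
    commutes with the exchange of the blanks. As that exchange changes the class, so does
    [tperm A B]. *)
Lemma slides_swap s A B : ~~ blank A -> ~~ blank B -> A != B ->
  slides 1 (tperm A B * s) = ~~ slides 1 s.
Proof.
move=> nA nB AB; pose r := tperm A B * tperm P Q.
have ordAB t : blank (tperm A B t) = blank t.
  by apply: blank_tperm; rewrite (negPf nA) (negPf nB).
have rB t : blank (r t) = blank t by rewrite permM blank_tpermPQ.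
have rPQ : r = tperm P Q * tperm A B by rewrite /r left_tpermPQ.
have [s0 [s0A s0B s0P s0Q]] : exists s0 : {perm G},
    [/\ s0 A = v, s0 B = x, s0 P = y & s0 Q = z].
  have [//||s0 [? ? ? ?]] := @perm_of_seqs _ [:: A; B; P; Q] _ _ _ claw_uniq.
    move: nA nB; rewrite /blank /= !inE !negb_or AB PQ => /andP[-> ->] /andP[-> ->].
    by [].
  by exists s0.
have rs0 : slides s0 (r * s0).
  have := @claw_slide _ P Q s0 _ _ _ _ claw_uniq vx vy vz.
  rewrite -s0A -s0B -s0P -s0Q !permK blankP blankQ => /(_ isT isT).
  by rewrite -tperm_mull -mulgA -tperm_mull mulgA.
have conj s' : slides s0 s' -> slides s' (r * s').
  move=> h; apply: connect_trans (slide_connect_left rB h).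
  by apply: connect_trans rs0; rewrite slide_connect_sym.
have rs : slides s (r * s).
  case: (slides_or s0 s) => /conj // h.
  have := slide_connect_left (blank_tpermPQ P Q) h.
  by rewrite [r * _]mulgA (left_tpermPQ PQ rB) !mulgA tperm2 !mul1g.
rewrite (slides_congr rs) rPQ -mulgA slides_swapPQ.
by rewrite negbK.
Qed.

Lemma side_tperm s A B : blank A = blank B -> A != B -> side (tperm A B * s) = side s.
Proof.
move=> bAB AB; rewrite /side odd_mul_tperm AB addTb addbN.
have -> : slides 1 (tperm A B * s) = ~~ slides 1 s; last by rewrite addNb negbK.
have [bA|nA] := boolP (blank A); last by apply: slides_swap; rewrite // -bAB.
have -> : tperm A B = tperm P Q; last exact: slides_swapPQ.
move: bA (bA) AB; rewrite {1}bAB.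
by move=> /orP[]/eqP-> /orP[]/eqP->; rewrite ?eqxx // tpermC.
Qed.

Lemma side_slide s s' : slide P Q s s' -> side s' = ~~ side s.
Proof.
move=> ss'; rewrite /side -(slides_congr (connect1 ss')).
case/slideP: ss' => A [B [AB _ ->]].
by rewrite odd_mul_tperm (contraNneq _ AB) ?addTb ?addbN // => ->.
Qed.

(** Induction on the number of moved tokens: splitting off [tperm t (r t)] makes [t] fixed. *)
Lemma side_fix s (r : {perm G}) : (forall t, blank t -> r t = t) -> side (r * s) = side s.
Proof.
have [m] := ubnP #|[set t | r t != t]|; elim: m r s => // m IH r s rm rB.
case: (pickP [pred t | r t != t]) => [t /= rt|none]; last first.
  suff -> : r = 1 by rewrite mul1g.
  by apply/permP => t; rewrite perm1; apply/eqP; have := none t => /negbFE.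
have nt : ~~ blank t by apply: contraNN rt => /rB ->.
have nrt : ~~ blank (r t).
  by apply: contraNN rt => /rB /perm_inj ->.
pose r' := r * tperm t (r t).
have -> : r = r' * tperm t (r t) by rewrite /r' -mulgA tperm2 mulg1.
have r'fix u : r u = u -> r' u = u.
  move=> ru; rewrite permM ru tpermD //; apply: contraNneq rt => h.
    by rewrite h ru.
  by apply/eqP; apply: (@perm_inj _ r); rewrite h ru.
rewrite -mulgA IH; first by apply: side_tperm; rewrite ?(negPf nt) ?(negPf nrt) // eq_sym.
  rewrite -ltnS; apply: leq_ltn_trans _ rm; apply: proper_card.
  apply/properP; split.
    by apply/subsetP => u; rewrite !inE; apply: contraNN => /eqP/r'fix ->.
  by exists t; rewrite !inE ?rt // permM tpermR eqxx.
by move=> u /rB; apply: r'fix.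
Qed.

Lemma side_blanks s s' : s P = s' P -> s Q = s' Q -> side s = side s'.
Proof.
move=> hP hQ; rewrite -[s'](mulgKV s) side_fix // => t.
by case/orP=> /eqP->; rewrite permM -?hP -?hQ permK.
Qed.

(** Some state with [P] at [a] and [Q] at [b], for distinct [a] and [b]; by [side_blanks], the
    places of the other tokens do not affect [side]. *)
Definition placed a b : {perm G} := tperm P a * tperm (tperm P a Q) b.

Lemma placedE a b : a != b -> placed a b P = a /\ placed a b Q = b.
Proof.
move=> ab; rewrite /placed !permM tpermL; split; last by rewrite tpermL.
rewrite tpermD //; last by rewrite eq_sym.
by rewrite -[X in _ != X](tpermL P a) (inj_eq perm_inj) eq_sym.
Qed.

Lemma side_placedC a b : a != b -> side (placed a b) = side (placed b a).
Proof.
move=> ab; rewrite -(@side_tperm (placed a b) P Q) ?blankP ?blankQ //.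
have [aP aQ] := placedE ab; have [bP bQ] : placed b a P = b /\ placed b a Q = a.
  by apply: placedE; rewrite eq_sym.
by apply: side_blanks; rewrite permM ?tpermL ?tpermR ?aP ?aQ.
Qed.

Lemma side_placed_edge a a' b : a != b -> a' != b -> sedge a a' ->
  side (placed a' b) = ~~ side (placed a b).
Proof.
move=> ab a'b aa'; have [hP hQ] := placedE ab; have [hP' hQ'] := placedE a'b.
have a'P : (placed a b)^-1 a' != P.
  rewrite -(inj_eq (@perm_inj _ (placed a b))) permKV hP eq_sym.
  by apply: contraTneq aa' => ->; rewrite sedge_irrefl.
have a'Q : (placed a b)^-1 a' != Q.
  by rewrite -(inj_eq (@perm_inj _ (placed a b))) permKV hQ.
rewrite -(@side_slide (placed a b) (placed a b * tperm a a')).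
  by apply: side_blanks; rewrite permM ?hP ?hQ ?tpermL ?tpermD // eq_sym.
apply/slideP; exists P, ((placed a b)^-1 a').
rewrite blankP permKV hP aa' tperm_mull permKV hP; split=> //.
by rewrite /blank (negPf a'P) (negPf a'Q).
Qed.

(* If b has neighbours a and a', then {a,b}, {a,a'}, {a',b} are successive
   positions of the blanks, so {a,b} and {a',b} lie on the same side. *)
Lemma side_bipartite : bipartite G.
Proof.
have nb (a a' : G) : sedge a a' -> a != a'.
  by move=> h; apply: contraTneq h => ->; rewrite sedge_irrefl.
have same a a' : sedge P a -> sedge P a' -> side (placed a P) = side (placed a' P).
  move=> Pa Pa'; have [-> //|aa'] := eqVneq a a'.
  have aP := nb _ _ Pa; have aP' := nb _ _ Pa'.
  have a'a : a' != a by rewrite eq_sym.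
  rewrite -[LHS](side_placedC aP) -[RHS](side_placedC aP').
  apply: negb_inj; rewrite -(side_placed_edge aP a'a Pa').
  by rewrite -(side_placed_edge aP' aa' Pa) side_placedC.
(* The vertex [P] now serves as a base point: another vertex [a] is coloured by the side of the
   blanks on [a] and [P], and [P] gets the colour opposite to its neighbours, which agree by [same].
   The value [false] is for an isolated [P]. *)
pose c a := if a == P then if [pick t | sedge P t] is Some t
                           then ~~ side (placed t P) else false
            else side (placed a P).
have cP a : sedge P a -> c P != c a.
  move=> Pa; rewrite /c eqxx [a == P]eq_sym (negPf (nb _ _ Pa)).
  case: pickP => [t Pt|/(_ a)]; last by rewrite Pa.
  by rewrite (same _ _ Pt Pa); case: side.
exists c => a b ab.
have [aP|aP] := eqVneq a P; first by rewrite aP in ab *; apply: cP.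
have [bP|bP] := eqVneq b P.
  by rewrite bP in ab *; rewrite eq_sym; apply: cP; rewrite sedge_sym.
rewrite /c (negPf aP) (negPf bP) (side_placed_edge aP bP ab).
by case: side.
Qed.

End NoSwap.

Lemma slides_all (v x y z : G) : uniq [:: v; x; y; z] ->
  sedge v x -> sedge v y -> sedge v z -> ~ bipartite G -> forall s s', slides s s'.
Proof.
move=> u4 vx vy vz nbip.
case: (pickP [pred s | slides s (tperm P Q * s)]) => [s0 h|none].
  exact: slides_all_of_swap h.
by case: nbip; apply: (side_bipartite _ u4) => // s; apply: negbT (none s).
Qed.

End Parity.

(** * Graphs of maximal degree two *)

Lemma longest_path (G : sgraph) : 0 < #|G| -> exists s : seq G,
  [/\ 0 < size s, uniq s, sorted (@sedge G) s
    & forall t : seq G, uniq t -> sorted (@sedge G) t -> size t <= size s].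
Proof.
case/card_gt0P=> x0 _.
pose p k := [exists t : k.-tuple G, uniq t && sorted (@sedge G) t].
have p1 : exists k, p k by exists 1%N; apply/existsP; exists [tuple x0].
have pb k : p k -> k <= #|G|.
  case/existsP=> t /andP[/card_uniqP ut _].
  by rewrite -(size_tuple t) -ut max_card.
case: (ex_maxnP p1 pb) => k /existsP[s /andP[us ss]] kmax.
have max t : uniq t -> sorted (@sedge G) t -> size t <= size s.
  move=> ut st; rewrite size_tuple; apply: kmax; apply/existsP; exists (in_tuple t).
  by rewrite /= ut.
by exists s; split=> //; apply: (max [:: x0]).
Qed.

(** A longest path covers the graph: its inner vertices have both neighbours on it, and it cannot be
    extended at its ends. If the ends are adjacent it closes up to the cycle; otherwise the parity
    of the index is a proper colouring. *)
Lemma max_degree2_cycle (G : sgraph) : connected_graph G -> ~ bipartite G ->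
  (forall v x y z : G, sedge v x -> sedge v y -> sedge v z -> ~~ uniq [:: x; y; z]) ->
  isomorphic G (cycle_graph #|G|).
Proof.
move=> [G0 conG] nbip deg2.
have [s [s0 us ss smax]] := longest_path G0.
have [x0 _] : exists x0 : G, x0 \in G by apply/card_gt0P.
pose k := size s; pose a i := nth x0 s i.
have step i : i.+1 < k -> sedge (a i) (a i.+1).
  by move=> ik; move/(sortedP x0): ss; apply.
have aI i j : i < k -> j < k -> (a i == a j) = (i == j) by move=> *; apply: nth_uniq.
have as_ i : i < k -> a i \in s by apply: mem_nth.
have inter i y : 0 < i -> i.+1 < k -> sedge (a i) y -> y = a i.-1 \/ y = a i.+1.
  case: i => // i _ ik e; have ik' := ltnW ik.
  have ei : sedge (a i.+1) (a i) by rewrite sedge_sym step.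
  have := deg2 _ _ _ _ ei (step _ ik) e.
  rewrite /= !inE !andbT negb_and !negbK aI ?(ltnW ik') // (ltn_eqF (leqnSn _)) /=.
  by case/orP=> /eqP <-; [left|right].
have ends i y : i < k -> (i == 0) || (i == k.-1) -> sedge (a i) y -> y \in s.
  move=> ik iE e; apply: contraT => ys.
  case/orP: iE => /eqP iE; subst i.
    have := smax (y :: s); rewrite /= ys us ltnn => h; apply: h => //.
    move: ss e; rewrite /a; case: (s) => //= z s' -> e.
    by rewrite sedge_sym e.
  have := smax (rcons s y); rewrite size_rcons rcons_uniq ys us ltnn => h; apply: h => //.
  move: ss e ik; rewrite /a /k nth_last; case: (s) => //= z s' zs' e _.
  by rewrite rcons_path zs'.
(* Cyclic adjacency of indices without reduction modulo [k], in a form suited to linear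
   arithmetic. *)
pose nxt i j := [|| j == i.+1, i == j.+1, (i == 0) && (j == k.-1) | (i == k.-1) && (j == 0)].
have nbrs i j : i < k -> j < k -> sedge (a i) (a j) -> nxt i j.
  move=> ik jk e; have e' : sedge (a j) (a i) by rewrite sedge_sym.
  have ij : i != j by apply: contraTneq e => ->; rewrite sedge_irrefl.
  have [/andP[i0 i1]|i_end] := boolP ((0 < i) && (i.+1 < k)).
    by case: (inter i (a j) i0 i1 e) => /eqP; rewrite aI /nxt; lia.
  have [/andP[j0 j1]|j_end] := boolP ((0 < j) && (j.+1 < k)).
    by case: (inter j (a i) j0 j1 e') => /eqP; rewrite aI /nxt; lia.
  by rewrite /nxt; lia.
have closed i y : i < k -> sedge (a i) y -> y \in s.
  move=> ik e; have [/andP[i0 i1]|i_end] := boolP ((0 < i) && (i.+1 < k)).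
    by case: (inter i y i0 i1 e) => ->; apply: as_; lia.
  have iE : (i == 0) || (i == k.-1) by lia.
  exact: ends ik iE e.
have all_s y : y \in s.
  have /connectP[p + ->] := conG (a 0) y; move: (as_ 0 s0).
  elim: p (a 0) => //= x p IH u us' /andP[ux]; apply: IH.
  by apply: (closed (index u s)); rewrite ?index_mem // /a nth_index.
have kG : k = #|G|.
  by rewrite /k -(card_uniqP us); apply: eq_card => y; rewrite all_s.
have idx y : index y s < k by rewrite index_mem.
have aK y : a (index y s) = y by apply: nth_index.
have [e0|ne0] := boolP (sedge (a k.-1) (a 0)); last first.
  case: nbip; exists (fun y => odd (index y s)) => x y xy.
  have := nbrs _ _ (idx x) (idx y); rewrite !aK => /(_ xy).
  rewrite sedge_sym in ne0; case/or4P=> [/eqP->|/eqP->|/andP[]|/andP[]].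
  - by rewrite /=; case: odd.
  - by rewrite /=; case: odd.
  - by move=> /eqP x0' /eqP yk; move: ne0; rewrite -x0' -yk !aK xy.
  - by move=> /eqP xk /eqP y0; move: ne0; rewrite sedge_sym -xk -y0 !aK xy.
rewrite -kG; pose f y : cycle_graph k := Ordinal (idx y).
have f_inj : injective f.
  by move=> x y /(congr1 val) /= h; rewrite -(aK x) -(aK y) h.
exists f; split; first by apply: inj_card_bij; rewrite // card_ord kG.
have succ i : i < k -> sedge (a i) (a (i.+1 %% k)).
  move=> ik; have [i1|i1] := ltnP i.+1 k; first by rewrite modn_small // step.
  have iE : i = k.-1 by lia.
  by rewrite iE prednK // modnn.
move=> x y; rewrite -[LHS]/(cycle_rel (f x) (f y)) /cycle_rel -!val_eqE /=.
rewrite -[in RHS](aK x) -[in RHS](aK y); have := idx x; have := idx y.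
move: (index x s) (index y s) => i j jk ik; apply/idP/idP.
  by case/andP=> _ /orP[]/eqP->; rewrite ?succ // sedge_sym succ.
move=> e; apply/andP; split; first by apply: contraTneq e => ->; rewrite sedge_irrefl.
have modE l : l < k -> l.+1 %% k = if l.+1 == k then 0 else l.+1.
  move=> lk; have [->|lk'] := eqVneq l.+1 k; first exact: modnn.
  by apply: modn_small; lia.
by have := nbrs i j ik jk e; rewrite /nxt !modE //; do 2!case: ifP; lia.
Qed.

(** * Invariants *)

Section Necessity.
Local Open Scope group_scope.
Variables (G : sgraph) (P Q : G).
Hypothesis PQ : P != Q.
Hypothesis slidesT : forall s s' : {perm G}, connect (slide P Q) s s'.
Implicit Types s : {perm G}.

Lemma slide_blankP s s' : slide P Q s s' ->
  exists a b, [/\ blank P Q a, ~~ blank P Q b, sedge (s a) (s b) & s' = tperm a b * s].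
Proof.
case/slideP=> a [b [ab e ->]]; have [ba|na] := boolP (blank P Q a).
  by exists a, b; split=> //; rewrite ba in ab.
exists b, a; split; rewrite // 1?tpermC // 1?sedge_sym //.
by rewrite (negPf na) in ab; case: (blank P Q b) ab.
Qed.

Lemma slides_invariant (f : {perm G} -> bool) :
  (forall s s', slide P Q s s' -> f s = f s') -> forall s s', f s = f s'.
Proof.
move=> fE s s'; have /connectP[p + ->] := slidesT s s'.
by elim: p s => //= s1 p IH s /andP[/fE -> /IH].
Qed.

(** The blank [P] never leaves its component. *)
Lemma slides_connected : connected_graph G.
Proof.
split=> [|x y]; first by apply/card_gt0P; exists P.
have := @slides_invariant (fun s => connect (@sedge G) x (s P)) _
          (tperm P x) (tperm P y).
rewrite !tpermL connect0 => <- // s s' /slideP[a [b [_ e ->]]].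
have csym : connect_sym (@sedge G) by apply: sym_connect_sym; apply: sedge_sym.
rewrite permM; case: tpermP => // ->.
  exact: (same_connect_r csym (connect1 e)).
by rewrite (same_connect_r csym (connect1 e)).
Qed.

(** A slide changes the sign and the colour of the moving blank, so [f] is kept; exchanging the
    blanks changes the sign alone. *)
Lemma slides_not_bipartite : ~ bipartite G.
Proof.
case=> c cE; pose f s := odd_perm s (+) c (s P) (+) c (s Q).
have fE s s' : slide P Q s s' -> f s = f s'.
  case/slide_blankP=> a [b [ba nb /cE e ->]].
  have ab : a != b by apply: contraNneq nb => <-.
  have bP : b != P by apply: contraNneq nb => ->; apply: blankP.
  have bQ : b != Q by apply: contraNneq nb => ->; apply: blankQ.
  have flip : c (s b) = ~~ c (s a) by case: (c (s a)) (c (s b)) e => [] [].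
  rewrite /f odd_mul_tperm ab !permM.
  case/orP: ba flip => /eqP-> flip; rewrite !tpermL tpermD // ?flip 1?eq_sym //.
    by case: odd_perm; case: (c _); case: (c _).
  by case: odd_perm; case: (c _); case: (c _).
have := slides_invariant fE 1 (tperm P Q).
rewrite /f odd_perm1 odd_tperm PQ tpermL tpermR !perm1.
by case: (c P); case: (c Q).
Qed.

(* The token t is assigned to the side A of the cut edge ab from which it
   cannot escape: t may cross the edge only while both blanks are on the
   other side, and then it blocks the edge until it steps back. *)
Definition trapped (A : {set G}) (a b p q t : G) :=
  (t \in A) && ~~ [&& t == a, p \notin A & q \notin A] ||
  [&& t == b, p \in A & q \in A].

Lemma trappedC A a b p q t : trapped A a b p q t = trapped A a b q p t.
Proof. by rewrite /trapped ![(q \in A) && _]andbC ![(q \notin A) && _]andbC. Qed.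

Lemma slides_no_cut : 2 < #|G| -> ~ (exists a b : G, nontrivial_cut_edge a b).
Proof.
move=> G3 [a [b [[ab ncon] da db]]].
pose A := [set x | connect (del_rel a b) a x].
have csym : connect_sym (del_rel a b) by apply: sym_connect_sym; apply: del_rel_sym.
have aA : a \in A by rewrite inE connect0.
have crossing x y : sedge x y -> (x \in A) != (y \in A) -> [set x; y] = [set a; b].
  move=> xy; apply: contraNeq => ne; apply/eqP; rewrite !inE.
  by apply: (same_connect_r csym); apply: connect1; rewrite /del_rel xy.
have [G0 conG] := slides_connected.
(* If [b] were still connected to [a], no edge would leave [A], and the graph would stay connected
   after the deletion. *)
have bA : b \notin A.
  apply/negP => bA; apply: ncon; split=> // x y.
  have all z : z \in A.
    suff gen p w : w \in A -> path (@sedge G) w p -> last w p \in A.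
      by have /connectP[p ap ->] := conG a z; apply: gen.
    elim: p w => //= u p IH w wA /andP[wu]; apply: IH; apply: contraT => uA.
    have /setP e : [set w; u] = [set a; b].
      by apply: crossing wu _; rewrite wA (negPf uA).
    have := e u; rewrite !inE eqxx orbT => /esym/orP[]/eqP ux.
      by rewrite ux aA in uA.
    by rewrite ux bA in uA.
  have := all x; have := all y; rewrite !inE => ay ax.
  by apply: connect_trans ay; rewrite csym.
have cross x y : sedge x y -> (x \in A) = (y \in A) \/
    (x = a /\ y = b) \/ (x = b /\ y = a).
  move=> xy; have [e|ne] := eqVneq (x \in A) (y \in A); first by left.
  right; have /setP e := crossing x y xy ne.
  have := e x; have := e y; rewrite !inE !eqxx orbT /=.
  by move=> /esym/orP[]/eqP yE /esym/orP[]/eqP xE; move: ne;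
    rewrite xE yE ?eqxx //; auto.
have nba : b != a by apply: contraNneq bA => ->.
(* A blank moves past a token at [t]. If it crosses the cut edge, [t] is neither [a] nor [b], and
   only the membership of [t] in [A] counts. *)
have tr1 p q r t : sedge p r -> t != p -> t != r ->
    trapped A a b p q t = trapped A a b r q t.
  move=> pr tp tr; rewrite /trapped.
  case: (cross p r pr) => [-> //|[] [pE rE]]; subst p r;
    by rewrite (negPf tp) (negPf tr) /=.
(* The token itself moves. If it crosses the cut edge, both sides reduce to [q \in A]. *)
have tr2 p q t : sedge p t -> trapped A a b p q t = trapped A a b t q p.
  move=> pt; rewrite /trapped.
  case: (cross p t pt) => [->|[] [pE tE]].
  - by case: (t \in A); rewrite /= ?andbF.
  - by subst p t; rewrite (negPf bA) aA !eqxx [a == b]eq_sym (negPf nba) /= orbF negbK.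
  - by subst p t; rewrite (negPf bA) aA !eqxx [a == b]eq_sym (negPf nba) /= orbF negbK.
have [t nt] : exists t, ~~ blank P Q t.
  have : 0 < #|~: [set P; Q]| by rewrite cardsCs setCK cards2 PQ subn_gt0.
  by case/card_gt0P => t; rewrite !inE; exists t.
have [tP tQ] : t != P /\ t != Q by move: nt; rewrite /blank negb_or => /andP.
have nbr (x y : G) : sedge x y -> degree x <> 1%N -> exists z, sedge x z /\ z != y.
  move=> xy dx; have : 0 < #|[set z | sedge x z] :\ y|.
    rewrite lt0n; apply/eqP => d0; apply: dx.
    by rewrite /degree (cardsD1 y) inE xy d0.
  by case/card_gt0P=> z; rewrite !inE => /andP[zy xz]; exists z.
have [x [ax xb]] := nbr a b ab da.
have [y [yb ya]] := nbr b a (etrans (sedge_sym _ _) ab) db.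
have xa : x != a by apply: contraTneq ax => ->; rewrite sedge_irrefl.
have yb' : y != b by apply: contraTneq yb => ->; rewrite sedge_irrefl.
have xA : x \in A.
  by case: (cross a x ax) => [<- //|[] [e1 e2]]; [rewrite e2 eqxx in xb|rewrite e2 eqxx in xa].
have yA : y \notin A.
  by case: (cross b y yb) => [<- //|[] [e1 e2]]; [rewrite e2 eqxx in yb'|rewrite e2 eqxx in ya].
pose f s := trapped A a b (s P) (s Q) (s t).
(* The token [t] is trapped at [x], which is in [A] and differs from [a], but not at [y], which is
   outside [A] and differs from [b]. *)
suff fE s s' : slide P Q s s' -> f s = f s'.
  have := slides_invariant fE (tperm t x) (tperm t y).
  by rewrite /f /trapped !tpermL xA (negPf xa) (negPf yA) (negPf yb').
case/slide_blankP=> [u [w [bu nw e ->]]].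
have [wP wQ] : w != P /\ w != Q by move: nw; rewrite /blank negb_or => /andP.
have QP : Q != P by rewrite eq_sym.
rewrite /f !permM; case/orP: bu e => /eqP-> e; rewrite tpermL.
  rewrite (tpermD PQ wQ); have [->|tw] := eqVneq t w; first by rewrite tpermR tr2.
  by rewrite tpermD 1?eq_sym // (tr1 _ _ (s w)) // (inj_eq perm_inj).
rewrite (tpermD QP wP) ![trapped _ _ _ (s P) _ _]trappedC.
have [->|tw] := eqVneq t w; first by rewrite tpermR tr2.
by rewrite tpermD 1?eq_sym // (tr1 _ _ (s w)) // (inj_eq perm_inj).
Qed.

End Necessity.

(** * Cycles: parity of the index and cyclic order of three tokens *)

Lemma cycle_stepE n (i j : 'I_n) : cycle_rel i j ->
  [|| j == i.+1 :> nat, i == j.+1 :> nat, (i == 0 :> nat) && (j == n.-1 :> nat)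
    | (i == n.-1 :> nat) && (j == 0 :> nat)].
Proof.
have modE (l : 'I_n) : l.+1 %% n = if l.+1 == n then 0 else l.+1.
  have := ltn_ord l; case: eqVneq => [->|ne] lt; first by rewrite modnn.
  by apply: modn_small; lia.
have := ltn_ord i; have := ltn_ord j.
rewrite /cycle_rel -!val_eqE /= !modE.
by do 2!case: ifP; lia.
Qed.

(** The index is coloured by its parity; the wrap-around edge joins 0 to [n.-1], which is odd. *)
Lemma isomorphic_even_cycle (G : sgraph) n :
  ~~ odd n -> isomorphic G (cycle_graph n) -> bipartite G.
Proof.
move=> n_even [f [_ fE]]; exists (fun x => odd (f x : 'I_n)) => x y.
rewrite -fE => /cycle_stepE; have := ltn_ord (f x).
by case: (f x) (f y) => i ? [j ?] /=; lia.
Qed.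

(** The orientation of a cyclic triple: for distinct entries the value is [false] exactly when [x],
    [y], [z] are increasing up to rotation. *)
Definition turn (x y z : nat) := (x < y) (+) (y < z) (+) (z < x).

Lemma turnC x y z : turn x y z = turn y z x.
Proof. by rewrite /turn -addbA addbC. Qed.

Lemma turn_swap x y z : x != y -> y != z -> z != x -> turn y x z = ~~ turn x y z.
Proof. by rewrite /turn; lia. Qed.

(** A unit step passes neither [y] nor [z], and a wrap-around step reverses two of the three
    comparisons. *)
Lemma turn_step n x x' y z : x < n -> x' < n -> y < n -> z < n ->
  [|| x' == x.+1, x == x'.+1, (x == 0) && (x' == n.-1) | (x == n.-1) && (x' == 0)] ->
  x != y -> x != z -> x' != y -> x' != z -> y != z -> turn x y z = turn x' y z.
Proof. by rewrite /turn => ? ? ? ? /or4P[]; lia. Qed.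

Section CycleNecessity.
Local Open Scope group_scope.
Variables (G : sgraph) (P Q : G).
Hypothesis PQ : P != Q.
Hypothesis slidesT : forall s s' : {perm G}, connect (slide P Q) s s'.
Implicit Types s : {perm G}.

(** Five vertices leave three tokens besides the blanks; slides preserve their cyclic order, whereas
    exchanging two of them reverses it. *)
Lemma slides_not_cycle n : 4 < #|G| -> ~ isomorphic G (cycle_graph n).
Proof.
move=> G5 [f [/bij_inj f_inj fE]].
have : 2 < #|~: [set P; Q]|.
  by have := cardsC [set P; Q]; rewrite cards2 PQ; lia.
case/card_gt2P=> A [B [C [[]]]]; rewrite !inE => nA nB nC [AB BC CA].
have BA : B != A by rewrite eq_sym.
have CB : C != B by rewrite eq_sym.
have AC : A != C by rewrite eq_sym.
pose g x : nat := f x : 'I_n.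
have gn x : g x < n by apply: ltn_ord.
have g_eq x y : (g x == g y) = (x == y) by rewrite /g (inj_eq val_inj) (inj_eq f_inj).
have gE x y : sedge x y -> [|| g y == (g x).+1, g x == (g y).+1,
    (g x == 0) && (g y == n.-1) | (g x == n.-1) && (g y == 0)]%N.
  by rewrite -fE; apply: cycle_stepE.
have step x x' y z : sedge x x' -> x != y -> x != z -> x' != y -> x' != z -> y != z ->
    turn (g x) (g y) (g z) = turn (g x') (g y) (g z).
  by move=> /gE h xy xz x'y x'z yz; apply: (@turn_step n); rewrite ?g_eq.
pose o s := turn (g (s A)) (g (s B)) (g (s C)).
suff oE s s' : slide P Q s s' -> o s = o s'.
  have := slides_invariant slidesT oE 1 (tperm A B).
  rewrite /o !perm1 tpermL tpermR tpermD //.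
  by rewrite (@turn_swap (g A)) ?g_eq //; case: turn.
case/slide_blankP=> u [w [bu nw e ->]].
have uN t : ~~ blank P Q t -> u != t by apply: contraNneq => <-.
have := uN _ nA; have := uN _ nB; have := uN _ nC => uC uB uA.
have := e; rewrite sedge_sym => e'.
rewrite /o !permM.
have [wA|wA] := eqVneq w A.
  subst w; rewrite tpermR !tpermD //.
  by apply: step; rewrite // (inj_eq perm_inj).
(* [turnC] rotates the triple so that the moving token comes first, as in [turn_step]. *)
have [wB|wB] := eqVneq w B.
  subst w; rewrite tpermR !tpermD // turnC [RHS]turnC.
  by apply: step; rewrite // (inj_eq perm_inj).
have [wC|wC] := eqVneq w C.
  subst w; rewrite tpermR !tpermD // -turnC -[RHS]turnC.
  by apply: step; rewrite // (inj_eq perm_inj).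
by rewrite !tpermD.
Qed.

End CycleNecessity.

(** * States as permutations *)

Section Transfer.
Variables (X Y : sgraph) (e : X -> Y) (e' : Y -> X).
Hypotheses (eK : cancel e e') (e'K : cancel e' e).
Variables P Q : Y.
Hypothesis XE : forall a b : X, sedge a b = (blank P Q (e a) != blank P Q (e b)).

Lemma fs_of_perm_subproof (s : {perm Y}) : bijectiveb [ffun x => s (e x)].
Proof.
apply/bijectivebP; exists (fun y => e' (s^-1 y)%g) => [x|y].
  by rewrite ffunE permK eK.
by rewrite ffunE e'K permKV.
Qed.

(** The bijection [e] names the vertices of [X], which are the tokens, by vertices of [Y]. *)
Definition fs_of_perm (s : {perm Y}) : friends_strangers X Y :=
  exist (fun f : {ffun X -> Y} => bijectiveb f) _ (fs_of_perm_subproof s).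

Lemma fs_of_permE s x : val (fs_of_perm s) x = s (e x).
Proof. by rewrite /= ffunE. Qed.

Lemma fs_of_perm_inj : injective fs_of_perm.
Proof.
move=> s s' h; apply/permP => y; rewrite -(e'K y) -!fs_of_permE.
by rewrite h.
Qed.

Lemma fs_of_perm_surj t : exists s, t = fs_of_perm s.
Proof.
have /bijectivebP t_bij := valP t.
have inj : injective (fun y => val t (e' y)).
  by move=> y z /(bij_inj t_bij) /(can_inj e'K).
exists (perm inj); apply: val_inj; apply/ffunP => x.
by rewrite fs_of_permE permE eK.
Qed.

Lemma fs_of_perm_edge s s' : sedge (fs_of_perm s) (fs_of_perm s') = slide P Q s s'.
Proof.
apply/idP/idP.
  case/existsP=> a /existsP[b /and5P[]]; rewrite !fs_of_permE => ab sab /eqP sa /eqP sb.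
  move=> /forallP sc; apply/slideP; exists (e a), (e b); rewrite -XE; split=> //.
  apply/permP => y; rewrite permM; case: tpermP => [->|->|/eqP ya /eqP yb] //.
  have := sc (e' y); rewrite !fs_of_permE e'K => /implyP h.
  by apply/esym/eqP/h; rewrite -!(inj_eq (can_inj eK)) e'K ya yb.
case/slideP=> a [b [ab sab s'E]]; apply/existsP; exists (e' a); apply/existsP; exists (e' b).
rewrite XE !fs_of_permE !e'K ab sab s'E !permM tpermL tpermR !eqxx /=.
apply/forallP => c; apply/implyP => /andP[ca cb].
rewrite !ffunE permM tpermD //.
  by apply: contraNneq ca => ->; rewrite eK.
by apply: contraNneq cb => ->; rewrite eK.
Qed.

Lemma fs_connectedE :
  connected_graph (friends_strangers X Y) <-> forall s s', connect (slide P Q) s s'.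
Proof.
split=> [[_ h] s s'|h].
  have /connectP[p pP lp] := h (fs_of_perm s) (fs_of_perm s').
  elim: p s pP lp => [|t p IH] s /=; first by move=> _ /fs_of_perm_inj ->.
  have [s1 ->] := fs_of_perm_surj t.
  move=> /andP[st pP] lp; apply: connect_trans (IH _ pP lp).
  by apply: connect1; rewrite -fs_of_perm_edge.
split=> [|t t']; first by apply/card_gt0P; exists (fs_of_perm 1%g).
have [s ->] := fs_of_perm_surj t; have [s' ->] := fs_of_perm_surj t'.
have /connectP[p pP ->] := h s s'; elim: p s pP => [|s1 p IH] s /=; first by rewrite connect0.
case/andP=> ss1 /IH; apply: connect_trans; apply: connect1.
by move: ss1; rewrite -fs_of_perm_edge.
Qed.

End Transfer.

Theorem theorem1p4 (n : nat) (n_ge4 : 4 <= n) (Y : sgraph) (card_Y : #|Y| = n) :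
  connected_graph (friends_strangers (complete_bipartite 2 (n - 2)) Y) <->
  [/\ connected_graph Y,
      ~ bipartite Y,
      ~ (exists a b : Y, nontrivial_cut_edge a b)
    & ~ isomorphic Y (cycle_graph n)].
Proof.
set X := complete_bipartite 2 (n - 2).
have XY : #|X| = #|Y| by rewrite card_sum !card_ord card_Y subnKC // ltnW // ltnW.
pose e (x : X) : Y := enum_val (cast_ord XY (enum_rank x)).
pose e' (y : Y) : X := enum_val (cast_ord (esym XY) (enum_rank y)).
have eK : cancel e e' by move=> x; rewrite /e /e' enum_valK cast_ordK enum_rankK.
have e'K : cancel e' e by move=> y; rewrite /e /e' enum_valK cast_ordKV enum_rankK.
pose P := e (inl ord0); pose Q := e (inl ord_max).
have PQ : P != Q by rewrite (inj_eq (can_inj eK)).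
have blankE x : blank P Q (e x) = if x is inl _ then true else false.
  rewrite /blank !(inj_eq (can_inj eK)); case: x => [i|//].
  by case: i => [[|[|m]] lt_m].
have XE (a b : X) : sedge a b = (blank P Q (e a) != blank P Q (e b)).
  by rewrite !blankE; case: a b => a [].
rewrite (fs_connectedE eK e'K XE); split=> [h|[conY nbip ncut ncyc]].
  have nbip := slides_not_bipartite PQ h.
  split=> //; first exact: slides_connected h.
    by apply: (slides_no_cut PQ h); rewrite card_Y ltnW.
  (* Four vertices leave only two tokens, hence no cyclic order, but the cycle of length four is
     bipartite. *)
  have [n4|n5] := leqP n 4.
    have -> : n = 4 by lia.
    by move=> iso4; case: nbip; apply: isomorphic_even_cycle iso4.
  by apply: (slides_not_cycle PQ h); rewrite card_Y.
(* A claw is found by finite search; if there is none, all degrees are at most two and [Y] would be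
   a cycle. *)
case: (pickP [pred t : Y * Y * Y * Y | let: (v, x, y, z) := t in
    [&& sedge v x, sedge v y, sedge v z & uniq [:: x; y; z]]]) => [t|none]; last first.
  case: ncyc; rewrite -card_Y; apply: max_degree2_cycle => // v x y z vx vy vz.
  by have := none (v, x, y, z); rewrite /= vx vy vz /= => ->.
case: t => [[[v x] y] z] /= /and4P[vx vy vz xyz].
have claw_uniq : uniq [:: v; x; y; z].
  apply/andP; split; last exact: xyz.
  rewrite !inE !negb_or.
  by apply/and3P; split; [move: vx|move: vy|move: vz];
    apply: contraTneq => <-; rewrite sedge_irrefl.
apply: (slides_all PQ _ claw_uniq vx vy vz nbip) => s s'.
apply: reach_all; apply: (good_setT PQ conY ncut (claw_good PQ claw_uniq vx vy vz)).
  exact: claw_spanned.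
have -> : [set v; x; y; z] = [set:: [:: v; x; y; z]].
  by apply/setP => t; rewrite !inE -!orbA.
by rewrite cardsE (card_uniqP claw_uniq).
Qed.
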